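(* Let $p\in(0,1)$ and $f(x_1,x_2)=-(x_1-p)(x_2-p)$. Then $$-\max_{\mu\in\mathcal{C}_p}\int f(x_1,x_2)\,d\mu=\min_{(X_1,X_2)\in\mathcal{C}_p}\mathrm{cov}(X_1,X_2)=\begin{cases}-\left(\frac{p(1-p)}{1+p}\right)^2 & \text{if } p\in\left(0,\frac13\right),\\[4pt] -\frac18\,p(1-p) & \text{if } p\in\left[\frac13,\frac23\right],\\[4pt] -\left(\frac{p(1-p)}{2-p}\right)^2 & \text{if } p\in\left(\frac23,1\right).\end{cases}$$
   Context: A probability distribution $\mu$ on $[0,1]^2$ is called coherent if there exist a probability space $(\Omega,\mathcal{F},\mathbb{P})$, a Bernoulli (i.e. $\{0,1\}$-valued) random variable $X$ on it, and two sub-sigma-algebras $\mathcal{F}_1,\mathcal{F}_2\subset\mathcal{F}$ such that $\mu$ is the joint distribution of $(X_1,X_2)$, where $X_i=\mathbb{E}[X\mid\mathcal{F}_i]$. For $p\in[0,1]$, $\mathcal{C}_p$ denotes the set of coherent distributions arising with $\mathbb{E}[X]=p$. One writes $(X_1,X_2)\in\mathcal{C}_p$ to indicate that the distribution of the random vector $(X_1,X_2)$ belongs to $\mathcal{C}_p$. *)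

(* Defs.v *)
From HB Require Import structures.
From mathcomp Require Import all_boot all_order all_algebra.
From mathcomp Require Import all_classical all_reals all_analysis.

Set Implicit Arguments.
Unset Strict Implicit.
Unset Printing Implicit Defensive.

Import Order.TTheory GRing.Theory Num.Theory.
Import numFieldNormedType.Exports.

Local Open Scope classical_set_scope.
Local Open Scope ring_scope.

Section joint_distribution.
Context d (T : measurableType d) (R : realType) (P : probability T R).

Definition rvpair (X1 X2 : {RV P >-> R}) : T -> R * R := fun w => (X1 w, X2 w).

Lemma measurable_rvpair (X1 X2 : {RV P >-> R}) :
  measurable_fun setT (rvpair X1 X2).
Proof.
by apply: measurable_fun_pair; exact: measurable_funPT.
Qed.

HB.instance Definition _ (X1 X2 : {RV P >-> R}) :=
  isMeasurableFun.Build _ _ _ _ (rvpair X1 X2) (measurable_rvpair X1 X2).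

Definition joint_distribution (X1 X2 : {RV P >-> R}) :
  probability (R * R)%type R := distribution P (rvpair X1 X2).

End joint_distribution.

Definition sub_sigma_algebra_of d (T : measurableType d)
    (F : set (set T)) : Prop :=
  sigma_algebra setT F /\ F `<=` measurable.

(* [is_cond_exp X F Y]: the random variable Y is a version of E[X | F]. *)
Definition is_cond_exp d (T : measurableType d) (R : realType)
    (P : probability T R) (X : {RV P >-> R}) (F : set (set T))
    (Y : {RV P >-> R}) : Prop :=
  [/\ forall B : set R, measurable B -> F (Y @^-1` B),
      P.-integrable setT (EFin \o Y)
    & forall A, F A ->
        (\int[P]_(w in A) (Y w)%:E = \int[P]_(w in A) (X w)%:E)%E].

(* The class C_p. A distribution on [0,1]^2 is encoded as a Borel probability
   measure on R^2 giving mass 1 to the unit square. The values of [mu] are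
   compared on measurable sets only: a measure is an unconstrained function
   outside of them. *)
Definition coherent (R : realType) (p : R) :
    set (probability (R * R)%type R) :=
  fun mu : probability (R * R)%type R =>
  mu (`[0, 1] `*` `[0, 1]) = 1%E /\
  exists d (T : measurableType d) (P : probability T R)
    (X : {RV P >-> R}) (F1 F2 : set (set T)) (X1 X2 : {RV P >-> R}),
    [/\ (forall w, X w = 0 \/ X w = 1) /\ ('E_P[X] = p%:E)%E,
        sub_sigma_algebra_of F1 /\ sub_sigma_algebra_of F2,
        is_cond_exp X F1 X1,
        is_cond_exp X F2 X2
      & forall A : set (R * R), measurable A ->
          mu A = joint_distribution X1 X2 A].

Definition is_max (R : realType) (E : set (\bar R)) (M : \bar R) : Prop :=
  E M /\ ubound E M.

Definition is_min (R : realType) (E : set (\bar R)) (m : \bar R) : Prop :=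
  E m /\ lbound E m.

Definition coherent_integrals (R : realType) (p : R) (f : R * R -> R) :
    set (\bar R) :=
  [set (\int[mu]_x (f x)%:E)%E | mu in coherent p].

Definition coherent_covariances (R : realType) (p : R) : set (\bar R) :=
  [set c | exists d (T : measurableType d) (P : probability T R)
      (X1 X2 : {RV P >-> R}),
      coherent p (joint_distribution X1 X2) /\ c = covariance P X1 X2].

Definition min_cov_value (R : realType) (p : R) : R :=
  if p < 1 / 3 then - (p * (1 - p) / (1 + p)) ^+ 2
  else if p <= 2 / 3 then - (1 / 8 * (p * (1 - p)))
  else - (p * (1 - p) / (2 - p)) ^+ 2.

(* Main.v *)
From HB Require Import structures.
Require Import Defs.
From mathcomp Require Import all_boot all_order all_algebra.
From mathcomp Require Import all_classical all_reals all_analysis.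
From mathcomp Require Import measurable_realfun.
From mathcomp Require Import ring lra.
Import Order.TTheory GRing.Theory Num.Theory.
Import numFieldNormedType.Exports.

Set SsrOldRewriteGoalsOrder.
Set Implicit Arguments.
Unset Strict Implicit.
Unset Printing Implicit Defensive.

Local Open Scope classical_set_scope.
Local Open Scope ring_scope.

(** Minimizing E[X1 X2] over coherent pairs is a linear program, and the proof
    is a pair of matching solutions of that program and of its dual.

    Lower bound.  A conditional expectation is orthogonal to its error: for
    bounded measurable phi, E[(X - Xi) phi(Xi)] = 0 ([cond_exp_orthogonal]).
    Adding two such zeros to E[X1 X2] and bounding the integrand pointwise on
    the unit square, by K0 where X = 0 and by K1 where X = 1, gives
    E[X1 X2] >= (1 - p) K0 + p K1 ([weak_duality]).  It remains to choose phi.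
    - For p in [1/3, 2/3], phi is affine.  This is the Hilbert space argument:
      with Z = X - p, the projections Yi = Xi - p of Z lie on the sphere of
      diameter [0, Z], and <Y1, Y2> = |Y1 + Y2 - Z/2|^2 / 2 - |Z|^2 / 8.
    - For p < 1/3 equality above would need negative values of Xi.  The optimal
      law is now carried by (0, a), (a, 0) where X = 0 and by (a, a) where
      X = 1, with a = 2p / (1 + p).  The two inequalities must be equalities at
      these points, which forces the value and the slope of phi at a; the
      function [potential a] satisfies these conditions and is dual feasible
      for every a in (0, 1/2].
    - For p > 2/3, exchange X with 1 - X ([dual_feasible_flip]).

    Attainment.  Complementary slackness in the middle case reads
    X1 + X2 = (3p + X) / 2, and following this relation from X1 = 0 gives a
    chain of four points on which X alternates and each point shares with the
    next one a coordinate.  With suitable masses the same chain is optimal for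
    every p ([coherent_chain]).

    The covariance and the integral of f depend on the joint law only, and both
    reduce to E[X1 X2] because E[Xi] = p ([coherent_moments]). *)

(** * The dual function for small p *)

Section algebra.
Variable R : realFieldType.
Implicit Types a x y p : R.

(** On the right of [a] this is a^3 / x, which makes x * potential a x constant,
    as tightness at (0, a) where X = 0 demands.  On the left it is the quadratic
    with the same value a^2 and slope - a at [a] whose leading coefficient makes
    (1 - x) * potential a x exceed a line by (1 - a) (a - x)^2 and a cubic term,
    the convexity that the inequality for X = 1 asks for. *)
Definition potential a x : R :=
  let s := a - Num.min x a in
  a ^+ 3 / Num.max x a + a * s + (1 - 2 * a) / (1 - a) * s ^+ 2.

Lemma potential_left a x : 0 < a -> x <= a ->
  potential a x = a ^+ 2 + a * (a - x) + (1 - 2 * a) / (1 - a) * (a - x) ^+ 2.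
Proof.
move=> a0 xa; rewrite /potential min_l// max_r//; congr (_ + _ + _).
by rewrite exprSr mulfK ?gt_eqF.
Qed.

Lemma potential_right a x : a <= x -> potential a x = a ^+ 3 / x.
Proof.
by move=> ax; rewrite /potential min_r// max_l// subrr expr0n !mulr0 !addr0.
Qed.

Lemma potential_right_mul a x : 0 < a -> a <= x -> x * potential a x = a ^+ 3.
Proof.
by move=> a0 ax; rewrite potential_right// mulrC divfK// gt_eqF// (lt_le_trans a0).
Qed.

Lemma potential_left_mul a x : 0 < a -> 2 * a <= 1 -> x <= a ->
  (1 - a) * potential a x =
  (1 - a) * (a ^+ 2 + a * (a - x)) + (1 - 2 * a) * (a - x) ^+ 2.
Proof.
by move=> a0 a1 xa; rewrite potential_left//; field; apply/eqP; lra.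
Qed.

Lemma potential_ge0 a x : 0 < a -> 2 * a <= 1 -> 0 <= potential a x.
Proof.
move=> a0 a1; rewrite /potential.
have sa : 0 <= a - Num.min x a by rewrite subr_ge0 ge_min lexx orbT.
rewrite addr_ge0 ?addr_ge0 ?mulr_ge0 ?divr_ge0 ?exprn_ge0 ?invr_ge0 ?sqr_ge0//;
  rewrite ?le_max//; lra.
Qed.

Lemma potential_le a x : 0 < a -> 2 * a <= 1 -> 0 <= x -> potential a x <= a.
Proof.
move=> a0 a1 x0; have [xa|ax] := leP x a.
  rewrite -(ler_pM2l (_ : 0 < 1 - a)); last by lra.
  rewrite potential_left_mul//.
  have : (a - x) ^+ 2 <= a ^+ 2 by rewrite ler_sqr ?nnegrE; lra.
  have : 0 <= a * (1 - 2 * a) ^+ 2 by rewrite mulr_ge0 ?sqr_ge0// ltW.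
  nra.
rewrite (potential_right (ltW ax)) ler_pdivrMr; last lra.
nra.
Qed.

Lemma potential_nonincreasing a x y : 0 < a -> 2 * a <= 1 ->
  x <= y -> potential a y <= potential a x.
Proof.
move=> a0 a1 xy; rewrite /potential.
have min_xy : Num.min x a <= Num.min y a by rewrite le_min !ge_min xy lexx orbT.
have max_xy : Num.max x a <= Num.max y a by rewrite ge_max !le_max xy lexx orbT.
have max0 z : 0 < Num.max z a by rewrite lt_max a0 orbT.
have min_a z : 0 <= a - Num.min z a by rewrite subr_ge0 ge_min lexx orbT.
have s_xy : a - Num.min y a <= a - Num.min x a by rewrite lerD2l lerN2.
rewrite !lerD//.
- by rewrite ler_wpM2l ?exprn_ge0 ?(ltW a0)// lef_pV2 ?posrE.
- by rewrite ler_wpM2l ?(ltW a0).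
- rewrite ler_wpM2l ?divr_ge0//; [lra|lra|].
  by rewrite ler_sqr ?nnegrE.
Qed.

(** The dual inequality for X = 0 when both coordinates are at most [a], after
    multiplication by 1 - a.  For a = 1/2 only the square of x + y - a
    remains; for smaller [a] this square still dominates the other term
    wherever that term is negative. *)
Lemma potential_left_poly_ge0 a x y : 0 < a -> 2 * a <= 1 ->
    0 <= x -> x <= a -> 0 <= y -> y <= a ->
  0 <= a * (1 - a) * (x + y - a) ^+ 2 + (1 - 2 * a) *
    ((1 - a) * (x * y) - (a - x) ^+ 2 * x - (a - y) ^+ 2 * y).
Proof.
move=> a0 a1 x0 xa y0 ya.
set de := x + y - a; pose d := 1 - 2 * a.
have -> : (1 - a) * (x * y) - (a - x) ^+ 2 * x - (a - y) ^+ 2 * y =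
  x * y * (d + 3 * de) - de ^+ 2 * (a + de) by rewrite /d /de; ring.
rewrite -/d; have d0 : 0 <= d by rewrite /d; lra.
(* If de >= 0, both coordinates are at least de, hence x * y >= de ^+ 2. *)
have [de0|de0] := leP 0 de.
  have xy : de ^+ 2 <= x * y.
    rewrite expr2 ler_pM//; rewrite /de; lra.
  have : 0 <= d * (x * y - de ^+ 2) * (d + 3 * de).
    by rewrite mulr_ge0 ?mulr_ge0 ?subr_ge0//; lra.
  have : 0 <= de ^+ 2 * d * de by rewrite !mulr_ge0 ?sqr_ge0.
  have : 0 <= de ^+ 2 * (d ^+ 2 + a ^+ 2).
    by rewrite mulr_ge0 ?addr_ge0 ?sqr_ge0.
  rewrite /d; nra.
(* Here x + y = a + de < a, and x * y is at most a quarter of its square. *)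
have e0 : 0 <= a + de by rewrite /de; lra.
have xy : 4 * (x * y) <= (a + de) ^+ 2.
  have : 0 <= (x - y) ^+ 2 by rewrite sqr_ge0.
  rewrite /de; nra.
have xy0 : 0 <= x * y by rewrite mulr_ge0.
have dd : - (d * (d + 3 * de)) <= 9 / 4 * de ^+ 2.
  have : 0 <= (d + 3 / 2 * de) ^+ 2 by rewrite sqr_ge0.
  nra.
have h1 : - (d * (x * y * (d + 3 * de))) <= 9 / 16 * de ^+ 2 * a ^+ 2.
  have -> : - (d * (x * y * (d + 3 * de))) = (x * y) * - (d * (d + 3 * de)) by ring.
  apply: (le_trans (ler_wpM2l xy0 dd)).
  have h : 4 * (x * y) <= a ^+ 2.
    apply: (le_trans xy); rewrite ler_sqr ?nnegrE//; lra.
  have := ler_wpM2r (sqr_ge0 de) h; lra.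
have h2 : 0 <= de ^+ 2 * d * - de.
  by rewrite mulr_ge0 ?oppr_ge0 ?(ltW de0)// mulr_ge0 ?sqr_ge0.
have h3 : 0 <= de ^+ 2 * a ^+ 2 by rewrite mulr_ge0 ?sqr_ge0.
rewrite /d in h1 h2 *; nra.
Qed.

(** The dual inequality for X = 1 when [a] separates the coordinates.  Equality
    holds at (a, a), where the second order terms of the potential absorb the
    product (x - a) (a - y), and at (1, 0); hence two regimes of [y], with
    different sums of squares. *)
Lemma potential_cross_poly_ge0 a x y : 0 < a -> 2 * a <= 1 ->
    a <= x -> x <= 1 -> 0 <= y -> y <= a ->
  0 <= a * (x - a) ^+ 2 + x * ((1 - a) * (a - y) ^+ 2 - (x - a) * (a - y)).
Proof.
move=> a0 a1 ax x1 y0 ya.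
have [h|h] := leP (y * (1 + a)) (a ^+ 2).
  have -> : a * (x - a) ^+ 2 + x * ((1 - a) * (a - y) ^+ 2 - (x - a) * (a - y))
    = y * (x - 2 * a + y) ^+ 2 + y * (1 - 2 * a + y) * (a - y)
      + (1 - x) * (a - y) * (a ^+ 2 - y * (1 + a)) by ring.
  apply: addr_ge0; first apply: addr_ge0.
  - by rewrite mulr_ge0 ?sqr_ge0.
  - by rewrite mulr_ge0 ?mulr_ge0//; lra.
  - by rewrite mulr_ge0 ?mulr_ge0//; lra.
(* Away from y = 0, the quadratic in x - a has no positive discriminant. *)
have yp : 0 < y.
  rewrite lt_neqAle y0 andbT; apply/eqP => y00.
  by move: h; rewrite -y00 mul0r ltNge sqr_ge0.
rewrite -(pmulr_rge0 _ yp).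
set w := 1 - a; set v := a - y.
have -> : y * (a * (x - a) ^+ 2 + x * (w * v ^+ 2 - (x - a) * v)) =
  (y * (x - a) - v * (a ^+ 2 + y * w) / 2) ^+ 2
  + v ^+ 2 * (4 * a * w * y - (a ^+ 2 + y * w) ^+ 2) / 4.
  by rewrite /w /v; field.
apply: addr_ge0; first exact: sqr_ge0.
apply: divr_ge0 => //; apply: mulr_ge0; first exact: sqr_ge0.
rewrite subr_ge0.
(* Each term of (a ^+ 2 + y * w) ^+ 2 is bounded by a multiple of a * y. *)
have h1 : a ^+ 2 * a ^+ 2 <= a ^+ 2 * (y * (1 + a)) by rewrite ler_wpM2l ?sqr_ge0// ltW.
have h2 : y * w ^+ 2 * y <= y * w ^+ 2 * a by rewrite ler_wpM2l// mulr_ge0 ?sqr_ge0.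
have h3 : 0 <= a * y * (3 - 5 * a) by rewrite mulr_ge0 ?mulr_ge0//; lra.
rewrite /w in h2 *; nra.
Qed.

Lemma potential_dual0 a x y : 0 < a -> 2 * a <= 1 -> 0 <= x <= 1 -> 0 <= y <= 1 ->
  - a ^+ 3 <= x * y - x * potential a x - y * potential a y.
Proof.
move=> a0 a1; wlog xy : x y / x <= y => [H|] /andP[x0 x1] /andP[y0 y1].
  have [xy|/ltW yx] := leP x y; first by apply: H; rewrite ?x0 ?y0.
  have := H y x yx; rewrite y0 y1 x0 x1 => /(_ isT isT); lra.
have [ya|/ltW ay] := leP y a.
  have xa : x <= a by lra.
  rewrite -(ler_pM2l (_ : 0 < 1 - a)); last by lra.
  have := potential_left_poly_ge0 a0 a1 x0 xa y0 ya.
  have := potential_left_mul a0 a1 xa; have := potential_left_mul a0 a1 ya.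
  set P := potential a x; set Q := potential a y => EQ EP H.
  have -> : (1 - a) * (x * y - x * P - y * Q) =
    (1 - a) * (x * y) - x * ((1 - a) * P) - y * ((1 - a) * Q) by ring.
  rewrite EP EQ -subr_ge0; move: H; congr (0 <= _); ring.
rewrite (potential_right_mul a0 ay).
have [xa|/ltW ax] := leP x a.
  have := potential_le a0 a1 x0; nra.
rewrite (potential_right_mul a0 ax).
have : a * a <= x * y by rewrite ler_pM// ltW.
nra.
Qed.

Lemma potential_dual1 a x y : 0 < a -> 2 * a <= 1 -> 0 <= x <= 1 -> 0 <= y <= 1 ->
  3 * a ^+ 2 - 2 * a ^+ 3 <=
  x * y + (1 - x) * potential a x + (1 - y) * potential a y.
Proof.
move=> a0 a1; wlog xy : x y / x <= y => [H|] /andP[x0 x1] /andP[y0 y1].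
  have [xy|/ltW yx] := leP x y; first by apply: H; rewrite ?x0 ?y0.
  have := H y x yx; rewrite y0 y1 x0 x1 => /(_ isT isT); lra.
(* [t z] is the line through the value of (1 - z) * potential a z at [a] that
   turns the inequality into (x - a) * (y - a) plus nonnegative remainders. *)
pose t z := 2 * a ^+ 2 - a ^+ 3 - a * z.
have L z : z <= a -> t z + (1 - a) * (a - z) ^+ 2 <= (1 - z) * potential a z.
  move=> za; rewrite potential_left// -subr_ge0.
  have -> : (1 - z) * (a ^+ 2 + a * (a - z) + (1 - 2 * a) / (1 - a) * (a - z) ^+ 2)
    - (t z + (1 - a) * (a - z) ^+ 2) = (1 - 2 * a) / (1 - a) * (a - z) ^+ 3.
    by rewrite /t; field; apply/eqP; lra.
  rewrite mulr_ge0 ?divr_ge0 ?exprn_ge0//; lra.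
have U z : a <= z -> t z + a / z * (z - a) ^+ 2 = (1 - z) * potential a z.
  by move=> az; rewrite potential_right// /t; field; apply/eqP; lra.
have K : x * y + t x + t y - (3 * a ^+ 2 - 2 * a ^+ 3) = (x - a) * (y - a).
  by rewrite /t; ring.
have L0 z : 0 <= (1 - a) * (a - z) ^+ 2.
  by rewrite mulr_ge0 ?sqr_ge0//; lra.
have [ya|/ltW ay] := leP y a.
  have xa : x <= a by lra.
  have := L x xa; have := L y ya; have := L0 x; have := L0 y.
  have : 0 <= (a - x) * (a - y) by rewrite mulr_ge0; lra.
  lra.
have U0 z : a <= z -> 0 <= a / z * (z - a) ^+ 2.
  by move=> az; rewrite mulr_ge0 ?sqr_ge0// divr_ge0; lra.
have [xa|/ltW ax] := leP x a; last first.
  have := U x ax; have := U y ay; have := U0 x ax; have := U0 y ay.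
  have : 0 <= (x - a) * (y - a) by rewrite mulr_ge0; lra.
  lra.
have : 0 <= a / y * (y - a) ^+ 2 + ((1 - a) * (a - x) ^+ 2 - (y - a) * (a - x)).
  have yp : 0 < y by lra.
  rewrite -(pmulr_rge0 _ yp).
  have := potential_cross_poly_ge0 a0 a1 ay y1 x0 xa; congr (0 <= _).
  by field; apply/eqP; lra.
have := L x xa; have := U y ay; lra.
Qed.

End algebra.

(** * Conditional expectations are orthogonal to their errors *)

Section orthogonality.
Context d (T : measurableType d) (R : realType) (P : probability T R).
Implicit Types X Y : {RV P >-> R}.

Lemma bounded_integrable (f : T -> R) (C : R) :
  measurable_fun setT f -> (forall w, `|f w| <= C) ->
  P.-integrable setT (EFin \o f).
Proof.
move=> mf fC; apply: measurable_bounded_integrable => //.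
  by rewrite (le_lt_trans (probability_le1 _ _)) ?ltry.
exists C; split; first exact: num_real.
by move=> x Cx w _; rewrite /= (le_trans (fC w)) ?ltW.
Qed.

Lemma integrable_Rsum (I : Type) (s : seq I) (f : I -> T -> R) :
  (forall i, P.-integrable setT (EFin \o f i)) ->
  P.-integrable setT (EFin \o (fun w => \sum_(i <- s) f i w)).
Proof.
move=> intf; have := integrable_sum measurableT s (fun i (_ : xpredT i) => intf i).
by apply: eq_integrable => // w _; rewrite /= sumEFin.
Qed.

Lemma Rintegral_sum (I : Type) (s : seq I) (f : I -> T -> R) :
  (forall i, P.-integrable setT (EFin \o f i)) ->
  \int[P]_w (\sum_(i <- s) f i w) = \sum_(i <- s) \int[P]_w f i w.
Proof.
move=> intf; elim: s => [|i s IH].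
  by under eq_Rintegral do rewrite big_nil; rewrite Rintegral_cst// mul0r big_nil.
under eq_Rintegral do rewrite big_cons.
by rewrite RintegralD ?IH ?big_cons//; exact: integrable_Rsum.
Qed.

Lemma cond_exp_orthogonal_set X Y (F : set (set T)) (B : set R) :
  is_cond_exp X F Y -> P.-integrable setT (EFin \o X) -> measurable B ->
  \int[P]_w ((X w - Y w) * \1_B (Y w)) = 0.
Proof.
move=> [FY iY XY] iX mB.
have mA : measurable (Y @^-1` B) by exact: measurable_funPTI.
transitivity (\int[P]_(w in Y @^-1` B) (X w - Y w)).
  rewrite [RHS]Rintegral_mkcond; apply: eq_Rintegral => w _.
  rewrite patchE indicE; have [|] := boolP (w \in Y @^-1` B).
    by rewrite !inE/= => YB; rewrite mem_set// mulr1.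
  by rewrite !notin_setE/= => YB; rewrite memNset// mulr0.
rewrite RintegralB//; last 2 first.
- exact: integrableS iX.
- exact: integrableS iY.
by rewrite /Rintegral XY ?subrr//; exact: FY.
Qed.

Import HBSimple.

(** Indicators [phi] give the defining property of E[X | F], simple functions
    follow by linearity, and these are dense in L1 of the law of [Y]; the error
    X - Y is bounded by 1, so the functional is continuous for that norm. *)
Lemma cond_exp_orthogonal X Y (F : set (set T)) (phi : R -> R) (C : R) :
  is_cond_exp X F Y -> (forall w, `|X w| <= 1) -> (forall w, `|X w - Y w| <= 1) ->
  measurable_fun setT phi -> (forall t, `|phi t| <= C) ->
  \int[P]_w ((X w - Y w) * phi (Y w)) = 0.
Proof.
move=> ceY X1 XY1 mphi phiC.
have iX : P.-integrable setT (EFin \o X) by exact: (@bounded_integrable _ 1).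
have mXY : measurable_fun setT (fun w => X w - Y w) by exact: measurable_funB.
have mYB (f : R -> R) : measurable_fun setT f -> measurable_fun setT (f \o Y).
  by move=> mf; exact: measurableT_comp.
have iphi : (distribution P Y).-integrable setT (EFin \o phi).
  apply: integrable_pushforward => //; first exact/measurable_EFinP.
  rewrite preimage_setT; apply: (@bounded_integrable (phi \o Y) C).
    exact: mYB.
  by move=> w; exact: phiC.
have [g [ig _ gphi]] := approximation_sfun_integrable measurableT iphi.
have XYbnd (h : R -> R) K t : `|h (Y t)| <= K -> `|(X t - Y t) * h (Y t)| <= K.
  by move=> hK; rewrite normrM -[K]mul1r ler_pM.
have g0 n : \int[P]_w ((X w - Y w) * g n (Y w)) = 0.
  have iG y : P.-integrable setT
      (EFin \o (fun w => (X w - Y w) * \1_(g n @^-1` [set y]) (Y w))).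
    apply: (@bounded_integrable _ 1).
      by apply: measurable_funM => //; apply: mYB; exact: measurable_indic.
    move=> w; apply: XYbnd.
    by rewrite indicE; case: (_ \in _); rewrite ?normr1 ?normr0.
  transitivity (\int[P]_w (\sum_(y <- finmap.enum_fset (fset_set (range (g n))))
      y * ((X w - Y w) * \1_(g n @^-1` [set y]) (Y w)))).
    apply: eq_Rintegral => w _; rewrite fimfunE fsbig_finite//= mulr_sumr.
    by apply: eq_bigr => i _; rewrite mulrCA.
  rewrite Rintegral_sum; last first.
    by move=> y; have := integrableZl measurableT y (iG y); exact: eq_integrable.
  rewrite big1// => y _; rewrite RintegralZl//.
  by rewrite (cond_exp_orthogonal_set ceY iX) ?mulr0//; exact: measurable_funPTI.
have bnd n : (`|\int[P]_w ((X w - Y w) * phi (Y w))|%:E <=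
    \int[distribution P Y]_t `|(phi t)%:E - (g n t)%:E|)%E.
  have mg : measurable_fun setT (g n) by exact: measurable_funP.
  have [K gK] : exists K, forall t, `|g n t| <= K.
    have [M [_ gM]] := simple_bounded (g n); exists (`|M| + 1) => t.
    by apply: gM => //; rewrite ltr_pwDr// ler_norm.
  have mB : measurable_fun setT (fun t => `|phi t - g n t|%:E).
    by apply/measurable_EFinP; apply: measurableT_comp => //; exact: measurable_funB.
  pose D w := (X w - Y w) * (phi (Y w) - g n (Y w)).
  have i1 : P.-integrable setT (EFin \o (fun w => (X w - Y w) * phi (Y w))).
    apply: (@bounded_integrable _ C) => [|w]; last exact: XYbnd.
    by apply: measurable_funM => //; exact: mYB.
  have i2 : P.-integrable setT (EFin \o (fun w => (X w - Y w) * g n (Y w))).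
    apply: (@bounded_integrable _ K) => [|w]; last exact: XYbnd.
    by apply: measurable_funM => //; exact: mYB.
  have iD : P.-integrable setT (EFin \o D).
    have := integrableB measurableT i1 i2.
    by apply: eq_integrable => // w _; rewrite /D /= mulrBr EFinB.
  have -> : \int[P]_w ((X w - Y w) * phi (Y w)) = \int[P]_w D w.
    under [RHS]eq_Rintegral do rewrite /D mulrBr.
    by rewrite RintegralB// g0 subr0.
  rewrite EFin_normr_Rintegral//.
  apply: (le_trans (le_abse_integral P measurableT (measurable_int _ iD))).
  rewrite ge0_integral_distribution//=.
  apply: ge0_le_integral => //.
  - apply/measurable_EFinP; apply: measurableT_comp => //.
    exact/measurable_EFinP/(measurable_int _ iD).
  - exact: (measurableT_comp mB (measurable_funPT Y)).
  - by move=> w _; rewrite /= lee_fin; exact: (XYbnd (fun t => phi t - g n t)).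
apply/eqP; rewrite -normr_le0 -lee_fin.
by apply: cvge_ge gphi; exact: nearW.
Qed.

End orthogonality.

(** Change of variables without integrability: both sides split into the same
    positive and negative parts. *)
Lemma integral_distributionT d d' (T : measurableType d) (T' : measurableType d')
    (R : realType) (P : probability T R) (X : {RV P >-> T'}) (f : T' -> \bar R) :
  measurable_fun setT f ->
  (\int[distribution P X]_y f y = \int[P]_w f (X w))%E.
Proof.
move=> mf; rewrite integralE [RHS]integralE; congr (_ - _)%E.
- rewrite ge0_integral_distribution//; last exact: measurable_funepos.
  by rewrite -funepos_comp.
- rewrite ge0_integral_distribution//; last exact: measurable_funeneg.
  by rewrite -funeneg_comp.
Qed.

(** * Coherent laws from variables with values in [0, 1] *)

Section model.
Context (R : realType).

Definition unit_clamp (t : R) : R := Num.max 0 (Num.min 1 t).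

Lemma unit_clamp_itv t : 0 <= unit_clamp t <= 1.
Proof. by rewrite /unit_clamp le_max lexx/= ge_max ler01 ge_min lexx. Qed.

Lemma unit_clamp_id t : 0 <= t <= 1 -> unit_clamp t = t.
Proof. by move=> /andP[t0 t1]; rewrite /unit_clamp min_r// max_r. Qed.

Lemma measurable_unit_clamp : measurable_fun setT unit_clamp.
Proof. by apply: measurable_maxr => //; exact: measurable_minr. Qed.

Lemma cond_exp_clamp d (T : measurableType d) (P : probability T R)
    (X Y : {RV P >-> R}) (F : set (set T)) (Z : {RV P >-> R}) :
  sub_sigma_algebra_of F -> is_cond_exp X F Y ->
  (forall w, Z w = unit_clamp (Y w)) ->
  {ae P, forall w, 0 <= Y w <= 1} -> is_cond_exp X F Z.
Proof.
move=> [_ FT] [FY iY XY] ZE Y01; split.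
- move=> B mB; have -> : Z @^-1` B = Y @^-1` (unit_clamp @^-1` B).
    by apply/seteqP; split=> w /=; rewrite ZE.
  apply: FY; rewrite -[X in measurable X]setTI.
  exact: measurable_unit_clamp.
- apply: (@bounded_integrable _ _ _ _ _ 1) => // w.
  by rewrite ZE; have /andP[z0 z1] := unit_clamp_itv (Y w); rewrite ger0_norm.
- move=> A FA; rewrite -XY//; apply: ae_eq_integral.
  + exact: FT.
  + by apply/measurable_EFinP; exact: measurable_funTS.
  + by apply/measurable_EFinP; exact: measurable_funTS.
  + by apply: filterS Y01 => w Yw _; rewrite ZE unit_clamp_id.
Qed.

(** A coherent law only forces the conditional expectations into [0, 1] almost
    surely.  Clamping them changes neither the law nor the conditioning, and
    makes every integrand below bounded everywhere. *)
Lemma coherent_model (p : R) (mu : probability (R * R)%type R) :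
  coherent p mu ->
  exists d (T : measurableType d) (P : probability T R) (X : {RV P >-> R})
    (F1 F2 : set (set T)) (Y1 Y2 : {RV P >-> R}),
    [/\ (forall w, X w = 0 \/ X w = 1) /\ 'E_P[X]%E = p%:E,
        is_cond_exp X F1 Y1 /\ is_cond_exp X F2 Y2,
        F1 setT /\ F2 setT,
        forall w, 0 <= Y1 w <= 1 /\ 0 <= Y2 w <= 1
      & forall (h : R * R -> R) C, measurable_fun setT h ->
          (forall x y, 0 <= x <= 1 -> 0 <= y <= 1 -> `|h (x, y)| <= C) ->
          (\int[mu]_z (h z)%:E)%E = (\int[P]_w h (Y1 w, Y2 w))%:E].
Proof.
move=> [musq [d [T [P [X [F1 [F2 [X1 [X2 [HX [sF1 sF2] ce1 ce2 muE]]]]]]]]]].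
have mY (U : {RV P >-> R}) : measurable_fun setT (unit_clamp \o U).
  exact: measurableT_comp measurable_unit_clamp _.
have mclamp2 : measurable_fun setT
    (fun z : R * R => (unit_clamp z.1, unit_clamp z.2)).
  apply: measurable_fun_pair; apply: measurableT_comp measurable_unit_clamp _;
    [exact: measurable_fst|exact: measurable_snd].
pose Y1 : {RV P >-> R} := HB.pack (unit_clamp \o X1)
  (isMeasurableFun.Build _ _ _ _ _ (mY X1)).
pose Y2 : {RV P >-> R} := HB.pack (unit_clamp \o X2)
  (isMeasurableFun.Build _ _ _ _ _ (mY X2)).
have msq : measurable (`[0, 1] `*` `[0, 1] : set (R * R)) by exact: measurableX.
have Psq : {ae P, forall w, (`[0, 1] `*` `[0, 1]) (X1 w, X2 w)}.
  exists (~` ((rvpair X1 X2) @^-1` (`[0, 1] `*` `[0, 1]))); split => //.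
    by apply: measurableC; rewrite -[X in measurable X]setTI; exact: measurable_rvpair.
  rewrite probability_setC; last first.
    by rewrite -[X in measurable X]setTI; exact: measurable_rvpair.
  have -> : P (rvpair X1 X2 @^-1` (`[0, 1] `*` `[0, 1])) = 1%E by rewrite -musq muE.
  by rewrite subee.
exists d, T, P, X, F1, F2, Y1, Y2; split => //.
- split; [apply: (cond_exp_clamp sF1 ce1)|apply: (cond_exp_clamp sF2 ce2)] => //.
  + by apply: filterS Psq => w [/=]; rewrite !in_itv.
  + by apply: filterS Psq => w [/=]; rewrite !in_itv.
- have F_setT (F : set (set T)) : sub_sigma_algebra_of F -> F setT.
    by move=> [[F0 FC _] _]; rewrite -(setD0 setT); exact: FC.
  by split; exact: F_setT.
- by move=> w; split; exact: unit_clamp_itv.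
- move=> h C mh hC.
  pose hc z := h (unit_clamp z.1, unit_clamp z.2).
  have mhc : measurable_fun setT hc by exact: measurableT_comp mh mclamp2.
  have -> : (\int[mu]_z (h z)%:E = \int[mu]_z (hc z)%:E)%E.
    apply: ae_eq_integral => //; try exact/measurable_EFinP.
    exists (~` (`[0, 1] `*` `[0, 1])); split.
    + exact: measurableC.
    + by apply: etrans (probability_setC mu msq) _; rewrite musq subee.
    + apply: subsetC => -[x y] [/=]; rewrite !in_itv/= => x01 y01 _.
      by rewrite /hc !unit_clamp_id.
  rewrite (eq_measure_integral (joint_distribution X1 X2)); last first.
    by move=> A mA _; exact: muE.
  rewrite integral_distributionT; last exact/measurable_EFinP.
  rewrite /Rintegral fineK//; apply: integrable_fin_num => //.
  apply: (@bounded_integrable _ _ _ _ _ C).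
    by have := measurableT_comp mhc (measurable_rvpair X1 X2).
  by move=> w; apply: hC; exact: unit_clamp_itv.
Qed.

End model.

(** * Weak duality *)

(** Integrate the pointwise bound K0 + (K1 - K0) X <=
    Y1 Y2 + (X - Y1) phi(Y1) + (X - Y2) phi(Y2). *)
Lemma weak_duality d (T : measurableType d) (R : realType) (P : probability T R)
    (X Y1 Y2 : {RV P >-> R}) (F1 F2 : set (set T)) (p : R)
    (phi : R -> R) (C K0 K1 : R) :
  (forall w, X w = 0 \/ X w = 1) -> 'E_P[X]%E = p%:E ->
  is_cond_exp X F1 Y1 -> is_cond_exp X F2 Y2 ->
  (forall w, 0 <= Y1 w <= 1 /\ 0 <= Y2 w <= 1) ->
  measurable_fun setT phi -> (forall t, 0 <= t <= 1 -> `|phi t| <= C) ->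
  (forall x y, 0 <= x <= 1 -> 0 <= y <= 1 ->
    K0 <= x * y - x * phi x - y * phi y) ->
  (forall x y, 0 <= x <= 1 -> 0 <= y <= 1 ->
    K1 <= x * y + (1 - x) * phi x + (1 - y) * phi y) ->
  (1 - p) * K0 + p * K1 <= \int[P]_w (Y1 w * Y2 w).
Proof.
move=> X01 EX ce1 ce2 Y01 mphi phiC hK0 hK1.
(* [phi] is controlled on [0, 1] only, so it is extended by constants. *)
pose psi := phi \o @unit_clamp R.
have mpsi : measurable_fun setT psi.
  exact: measurableT_comp mphi (@measurable_unit_clamp R).
have psiC t : `|psi t| <= C by apply: phiC; exact: unit_clamp_itv.
have psiE t : 0 <= t <= 1 -> psi t = phi t by move=> t01; rewrite /psi/= unit_clamp_id.
have X1 w : `|X w| <= 1 by case: (X01 w) => ->; rewrite ?normr0 ?normr1.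
have XY w t : 0 <= t <= 1 -> `|X w - t| <= 1.
  by move=> /andP[t0 t1]; rewrite ler_norml; case: (X01 w) => ->; apply/andP; split; lra.
have bint (f : T -> R) C' : measurable_fun setT f -> (forall w, `|f w| <= C') ->
  P.-integrable setT (EFin \o f) by exact: bounded_integrable.
have iX : P.-integrable setT (EFin \o X) by exact: bint X1.
have XE : \int[P]_w X w = p by rewrite /Rintegral -expectation_def EX.
have orth (F : set (set T)) (Y : {RV P >-> R}) : is_cond_exp X F Y ->
    (forall w, 0 <= Y w <= 1) ->
    P.-integrable setT (EFin \o (fun w => (X w - Y w) * psi (Y w))) /\
    \int[P]_w ((X w - Y w) * psi (Y w)) = 0.
  move=> ceY Y01'; split; last first.
    by apply: cond_exp_orthogonal ceY X1 _ mpsi psiC => w; exact: XY.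
  apply: (bint _ C).
    apply: measurable_funM; first exact: measurable_funB.
    by have := measurableT_comp mpsi (measurable_funPT Y).
  by move=> w; rewrite normrM -[C]mul1r ler_pM// XY.
have [i1 o1] := orth F1 Y1 ce1 (fun w => (Y01 w).1).
have [i2 o2] := orth F2 Y2 ce2 (fun w => (Y01 w).2).
have iYY : P.-integrable setT (EFin \o (fun w => Y1 w * Y2 w)).
  apply: (bint _ 1); first exact: measurable_funM.
  move=> w; have [/andP[a0 a1] /andP[b0 b1]] := Y01 w.
  by rewrite ger0_norm ?mulr_ge0// -[leRHS]mul1r ler_pM.
have iL : P.-integrable setT (EFin \o (fun w => K0 + (K1 - K0) * X w)).
  apply: (bint _ (`|K0| + `|K1 - K0|)).
    by apply: measurable_funD => //; exact: measurable_funM.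
  move=> w; rewrite (le_trans (ler_normD _ _))// lerD2l normrM.
  by rewrite ler_piMr.
have i12 := integrableD measurableT i1 i2.
have iU := integrableD measurableT iYY i12.
have LE : (1 - p) * K0 + p * K1 = \int[P]_w (K0 + (K1 - K0) * X w).
  rewrite RintegralD//; last 2 first.
  - by apply: (bint _ `|K0|).
  - by have := integrableZl measurableT (K1 - K0) iX.
  rewrite Rintegral_cst// RintegralZl// XE.
  have -> : fine (P setT) = 1 by rewrite probability_setT.
  by ring.
have UE : \int[P]_w (Y1 w * Y2 w) = \int[P]_w (Y1 w * Y2 w +
    ((X w - Y1 w) * psi (Y1 w) + (X w - Y2 w) * psi (Y2 w))).
  by rewrite RintegralD// RintegralD// o1 o2 !addr0.
rewrite LE UE; apply: le_Rintegral => // w _.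
have [a01 b01] := Y01 w; rewrite !psiE//.
have := hK0 _ _ a01 b01; have := hK1 _ _ a01 b01.
by case: (X01 w) => ->; lra.
Qed.

(** The inequalities are those for X = 0 and X = 1, the two dual functions
    being taken equal: averaging over the exchange of coordinates shows that this
    loses nothing. *)
Definition dual_feasible (R : realType) (phi : R -> R) (K0 K1 : R) :=
  [/\ measurable_fun setT phi,
      exists C, forall t, 0 <= t <= 1 -> `|phi t| <= C,
      forall x y, 0 <= x <= 1 -> 0 <= y <= 1 ->
        K0 <= x * y - x * phi x - y * phi y
    & forall x y, 0 <= x <= 1 -> 0 <= y <= 1 ->
        K1 <= x * y + (1 - x) * phi x + (1 - y) * phi y].

(** [M] is E[X1 X2], computed in a model where X1 and X2 take values in [0, 1]. *)
Lemma coherent_moments (R : realType) (p : R) (mu : probability (R * R)%type R) :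
  coherent p mu ->
  exists M : R,
    [/\ (\int[mu]_z (z.1)%:E = p%:E)%E, (\int[mu]_z (z.2)%:E = p%:E)%E,
        (\int[mu]_z ((z.1 - p) * (z.2 - p))%:E = (M - p ^+ 2)%:E)%E,
        (\int[mu]_z (- ((z.1 - p) * (z.2 - p)))%:E = (p ^+ 2 - M)%:E)%E
      & forall phi K0 K1, dual_feasible phi K0 K1 -> (1 - p) * K0 + p * K1 <= M].
Proof.
move=> /coherent_model[d [T [P [X [F1 [F2 [Y1 [Y2 H]]]]]]]].
have [[X01 EX] [ce1 ce2] [F1T F2T] Y01 muE] := H.
have bint (f : T -> R) C' : measurable_fun setT f -> (forall w, `|f w| <= C') ->
  P.-integrable setT (EFin \o f) by exact: bounded_integrable.
have XE : \int[P]_w X w = p by rewrite /Rintegral -expectation_def EX.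
have YE (F : set (set T)) (Y : {RV P >-> R}) : is_cond_exp X F Y -> F setT ->
    \int[P]_w Y w = p.
  by move=> [_ _ FE] FT; rewrite -XE /Rintegral FE.
have n01 (x : R) : 0 <= x <= 1 -> `|x| <= 1 by move=> /andP[? ?]; rewrite ger0_norm.
have iY1 : P.-integrable setT (EFin \o Y1).
  by apply: (bint _ 1) => // w; have [? ?] := Y01 w; exact: n01.
have iY2 : P.-integrable setT (EFin \o Y2).
  by apply: (bint _ 1) => // w; have [? ?] := Y01 w; exact: n01.
have iYY : P.-integrable setT (EFin \o (fun w => Y1 w * Y2 w)).
  apply: (bint _ 1); first exact: measurable_funM.
  move=> w; have [/andP[a0 a1] /andP[b0 b1]] := Y01 w.
  by rewrite ger0_norm ?mulr_ge0// -[leRHS]mul1r ler_pM.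
have m1 : measurable_fun setT (fun z : R * R => z.1) by exact: measurable_fst.
have m2 : measurable_fun setT (fun z : R * R => z.2) by exact: measurable_snd.
have mh : measurable_fun setT (fun z : R * R => (z.1 - p) * (z.2 - p)).
  by apply: measurable_funM; exact: measurable_funB.
have hb (x y : R) : 0 <= x <= 1 -> 0 <= y <= 1 ->
    `|(x - p) * (y - p)| <= (1 + `|p|) * (1 + `|p|).
  move=> x01 y01; rewrite normrM ler_pM// (le_trans (ler_normB _ _))// lerD2r;
  exact: n01.
have E : \int[P]_w ((Y1 w - p) * (Y2 w - p)) = \int[P]_w (Y1 w * Y2 w) - p ^+ 2.
  have iL : P.-integrable setT (EFin \o (fun w => p * (Y1 w + Y2 w - p))).
    apply: (bint _ (`|p| * (1 + 1 + `|p|))).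
      apply: measurable_funM => //; apply: measurable_funB => //.
      exact: measurable_funD.
    move=> w; have [y1 y2] := Y01 w; rewrite normrM ler_wpM2l//.
    rewrite (le_trans (ler_normB _ _))// lerD2r (le_trans (ler_normD _ _))//.
    by rewrite lerD// n01.
  transitivity (\int[P]_w (Y1 w * Y2 w - p * (Y1 w + Y2 w - p))).
    by apply: eq_Rintegral => w _; ring.
  rewrite RintegralB//; congr (_ - _).
  have iS := integrableD measurableT iY1 iY2.
  have ip : P.-integrable setT (EFin \o (fun=> p)) by apply: (bint _ `|p|).
  rewrite RintegralZl//; last by have := integrableB measurableT iS ip.
  rewrite RintegralB// RintegralD// (YE _ _ ce1)// (YE _ _ ce2)//.
  rewrite Rintegral_cst//.
  have -> : fine (P setT) = 1 by rewrite probability_setT.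
  by ring.
exists (\int[P]_w (Y1 w * Y2 w)); split.
- rewrite (muE (fun z => z.1) 1)//; last by move=> x y ? ?; exact: n01.
  by rewrite (YE _ _ ce1).
- rewrite (muE (fun z => z.2) 1)//; last by move=> x y ? ?; exact: n01.
  by rewrite (YE _ _ ce2).
- by rewrite (muE _ ((1 + `|p|) * (1 + `|p|)))// E.
- rewrite (muE _ ((1 + `|p|) * (1 + `|p|)))//; last 2 first.
  + by apply: measurableT_comp mh.
  + by move=> x y ? ?; rewrite normrN hb.
  rewrite /= -(opprB _ (p ^+ 2)) -E; congr EFin.
  under eq_Rintegral do rewrite -mulN1r.
  rewrite RintegralZl ?mulN1r//; apply: (bint _ ((1 + `|p|) * (1 + `|p|))).
    by apply: measurable_funM; exact: measurable_funB.
  by move=> w; have [? ?] := Y01 w; exact: hb.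
- move=> phi K0 K1 [mphi [C phiC] h0 h1].
  exact: weak_duality X01 EX ce1 ce2 Y01 mphi phiC h0 h1.
Qed.

(** The variables carrying the law need not be conditional expectations
    themselves, but they have mean [p] because their law does. *)
Lemma coherent_covariance d (T : measurableType d) (R : realType) (P : probability T R)
    (X1 X2 : {RV P >-> R}) (p : R) :
  coherent p (joint_distribution X1 X2) ->
  (covariance P X1 X2 =
   \int[joint_distribution X1 X2]_z ((z.1 - p) * (z.2 - p))%:E)%E.
Proof.
move=> /coherent_moments[M [E1 E2 _ _ _]].
have m1 : measurable_fun setT (fun z : R * R => z.1) by exact: measurable_fst.
have m2 : measurable_fun setT (fun z : R * R => z.2) by exact: measurable_snd.
rewrite integral_distributionT in E1; last exact/measurable_EFinP.
rewrite integral_distributionT in E2; last exact/measurable_EFinP.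
rewrite integral_distributionT; last first.
  by apply/measurable_EFinP; apply: measurable_funM; exact: measurable_funB.
by rewrite unlock !expectation_def E1 E2.
Qed.

(** * Dual certificates for all p *)

Section certificates.
Variable R : realType.
Implicit Types (a p : R) (phi : R -> R).

Lemma dual_feasible_low a : 0 < a -> 2 * a <= 1 ->
  dual_feasible (potential a) (- a ^+ 3) (3 * a ^+ 2 - 2 * a ^+ 3).
Proof.
move=> a0 a1; split.
- by apply: nonincreasing_measurable => // x y; exact: potential_nonincreasing.
- exists a => t /andP[t0 _].
  by rewrite ger0_norm ?potential_ge0// potential_le.
- by move=> x y; exact: potential_dual0.
- by move=> x y; exact: potential_dual1.
Qed.

(** Both inequalities complete a square, which vanishes exactly when
    x + y = (3 p + X) / 2. *)
Lemma dual_feasible_middle p :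
  dual_feasible (fun t => p - (t - p) / 2)
    (- p ^+ 2 / 8 - p ^+ 2) (- (1 - p) ^+ 2 / 8 - p ^+ 2 + 2 * p).
Proof.
split.
- by apply: measurable_funB => //; apply: measurable_funM => //; exact: measurable_funB.
- exists (2 * `|p| + 1) => t /andP[t0 t1].
  by rewrite ler_norml; have := ler_norm p; have := ler_norm (- p); rewrite normrN; lra.
- move=> x y _ _; rewrite -subr_ge0.
  have -> : x * y - x * (p - (x - p) / 2) - y * (p - (y - p) / 2) -
      (- p ^+ 2 / 8 - p ^+ 2) = (x + y - 3 / 2 * p) ^+ 2 / 2 by field.
  by rewrite divr_ge0 ?sqr_ge0.
- move=> x y _ _; rewrite -subr_ge0.
  have -> : x * y + (1 - x) * (p - (x - p) / 2) + (1 - y) * (p - (y - p) / 2) -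
      (- (1 - p) ^+ 2 / 8 - p ^+ 2 + 2 * p) = (x + y - 3 / 2 * p - 1 / 2) ^+ 2 / 2.
    by field.
  by rewrite divr_ge0 ?sqr_ge0.
Qed.

(** Replace X, x, y by 1 - X, 1 - x, 1 - y.  Then X - x changes sign, and
    x y = (1 - x) (1 - y) - 1 + 2 X - (X - x) - (X - y) accounts for the
    constants. *)
Lemma dual_feasible_flip phi K0 K1 : dual_feasible phi K0 K1 ->
  dual_feasible (fun t => 1 - phi (1 - t)) (K1 - 1) (K0 + 1).
Proof.
have flip (t : R) : 0 <= t <= 1 -> 0 <= 1 - t <= 1 by lra.
move=> [mphi [C phiC] h0 h1]; split.
- apply: measurable_funB => //; apply: (measurableT_comp mphi).
  exact: measurable_funB.
- exists (1 + C) => t /flip t01.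
  by rewrite (le_trans (ler_normB _ _))// normr1 lerD2l phiC.
- by move=> x y /flip x01 /flip y01; have := h1 _ _ x01 y01; lra.
- by move=> x y /flip x01 /flip y01; have := h0 _ _ x01 y01; lra.
Qed.

Lemma exists_dual_certificate p : 0 < p -> p < 1 ->
  exists phi K0 K1, dual_feasible phi K0 K1 /\
    min_cov_value p + p ^+ 2 = (1 - p) * K0 + p * K1.
Proof.
move=> p0 p1; rewrite /min_cov_value; case: ltP => [plt|ple].
  (* The posterior in the optimal law: mass p out of p + (1 - p) / 2. *)
  pose a := 2 * p / (1 + p).
  have a0 : 0 < a by rewrite divr_gt0; lra.
  have a1 : 2 * a <= 1.
    by rewrite /a mulrA ler_pdivrMr; lra.
  exists (potential a), (- a ^+ 3), (3 * a ^+ 2 - 2 * a ^+ 3); split.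
    exact: dual_feasible_low.
  by rewrite /a; field; apply/eqP; lra.
case: leP => [ple2|pgt].
  exists (fun t => p - (t - p) / 2), (- p ^+ 2 / 8 - p ^+ 2),
    (- (1 - p) ^+ 2 / 8 - p ^+ 2 + 2 * p); split.
    exact: dual_feasible_middle.
  by field.
pose a := 2 * (1 - p) / (2 - p).
have a0 : 0 < a by rewrite divr_gt0; lra.
have a1 : 2 * a <= 1 by rewrite /a mulrA ler_pdivrMr; lra.
exists (fun t => 1 - potential a (1 - t)), (3 * a ^+ 2 - 2 * a ^+ 3 - 1),
  (- a ^+ 3 + 1); split.
  exact/dual_feasible_flip/dual_feasible_low.
by rewrite /a; field; apply/eqP; lra.
Qed.

End certificates.

(** * Optimal coherent laws *)

Section finite_support.
Variables (R : realType) (m : nat -> R) (n : nat).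
Hypothesis m0 : forall i, 0 <= m i.
Hypothesis m1 : \sum_(i < n) m i = 1.

Definition finite_mass : {measure set nat -> \bar R} :=
  msum (fun i => mscale (NngNum (m0 i)) (dirac i)) n.

Lemma integral_finite_mass (A : set nat) (f : nat -> R) :
  (\int[finite_mass]_(i in A) (f i)%:E =
   (\sum_(i < n) m i * (\1_A i * f i))%:E)%E.
Proof.
have pos (g : nat -> \bar R) : (forall i, 0 <= g i)%E ->
    (\int[finite_mass]_(i in A) g i =
     \sum_(i < n) (m i)%:E * ((\1_A (i : nat))%:E * g i))%E.
  move=> g0; rewrite ge0_integral_measure_sum//.
  apply: eq_bigr => i _; rewrite ge0_integral_mscale//.
  by rewrite integral_dirac//.
have EFin_pos (x : R) : (maxe x%:E 0 = (Num.max x 0)%:E)%E by rewrite EFin_max.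
rewrite integralE !pos//.
under eq_bigr do rewrite funeposE EFin_pos -!EFinM.
under [X in (_ - X)%E]eq_bigr do rewrite funenegE -EFinN EFin_pos -!EFinM.
rewrite !sumEFin -EFinB -sumrB; congr EFin; apply: eq_bigr => i _.
rewrite -!mulrBr; congr (_ * (_ * _)).
have [f0|f0] := leP (f i) 0.
  by rewrite max_l ?oppr_ge0//; ring.
by rewrite max_r ?oppr_le0 ?ltW//; ring.
Qed.

Lemma exists_finite_probability :
  exists P : probability nat R, forall (A : set nat) (f : nat -> R),
    (\int[P]_(i in A) (f i)%:E = (\sum_(i < n) m i * (\1_A i * f i))%:E)%E.
Proof.
have P1 : finite_mass setT = 1%E.
  have := integral_finite_mass setT (fun=> 1).
  rewrite integral_cst// mul1e => ->; rewrite -m1; congr EFin.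
  by apply: eq_bigr => i _; rewrite m1 indicE in_setT !mulr1.
pose P : probability nat R := HB.pack
  (Measure.sort finite_mass) (Measure.class finite_mass)
  (Measure_isProbability.Build _ _ _ finite_mass P1).
by exists P => A f; exact: integral_finite_mass.
Qed.

End finite_support.

(** Points 0, 1, 2, 3 have X = 0, 1, 0, 1.  The first observer cannot
    distinguish 1 from 2; the second one learns only whether the point is in
    {0, 1} or in {2, 3}. *)
Section chain.
Variables (R : realType) (m0 m1 m2 m3 : R).
Hypotheses (m0_ge0 : 0 <= m0) (m1_gt0 : 0 < m1) (m2_gt0 : 0 < m2) (m3_ge0 : 0 <= m3).
Hypothesis m_sum : m0 + m1 + m2 + m3 = 1.

Let b := m1 / (m0 + m1).
Let c := m1 / (m1 + m2).
Let e := m3 / (m2 + m3).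

(** The remaining points of [nat] are null; on them all variables take the
    default value 0. *)
Lemma coherent_chain (p : R) : p = m1 + m3 ->
  exists (P : probability nat R) (X1 X2 : {RV P >-> R}),
    coherent p (joint_distribution X1 X2) /\
    (covariance P X1 X2 = (m1 * c * b + m2 * c * e + m3 * e - p ^+ 2)%:E)%E.
Proof.
move=> pE.
pose m : nat -> R := nth 0 [:: m0; m1; m2; m3].
have m_ge0 i : 0 <= m i.
  by rewrite /m; case: i => [|[|[|[|i]]]]//=; [exact: ltW|exact: ltW|rewrite nth_nil].
have msum1 : \sum_(i < 4) m i = 1.
  by apply: etrans m_sum; rewrite !big_ord_recr big_ord0 /m/= add0r.
have [P intP] := exists_finite_probability m_ge0 msum1.
have rv (f : nat -> R) : measurable_fun setT f by [].
pose X : {RV P >-> R} := HB.pack (nth 0 [:: 0; 1; 0; 1] : nat -> R)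
  (isMeasurableFun.Build _ _ _ _ _ (rv (nth 0 [:: 0; 1; 0; 1]))).
pose X1 : {RV P >-> R} := HB.pack (nth 0 [:: 0; c; c; 1] : nat -> R)
  (isMeasurableFun.Build _ _ _ _ _ (rv (nth 0 [:: 0; c; c; 1]))).
pose X2 : {RV P >-> R} := HB.pack (nth 0 [:: b; b; e; e] : nat -> R)
  (isMeasurableFun.Build _ _ _ _ _ (rv (nth 0 [:: b; b; e; e]))).
exists P, X1, X2.
have ratio01 (x y : R) : 0 <= x -> 0 <= y -> 0 < x + y -> 0 <= x / (y + x) <= 1.
  move=> x0 y0 xy; rewrite divr_ge0 ?addr_ge0// (addrC y)/=.
  by rewrite ler_pdivrMr// mul1r lerDl.
have b01 : 0 <= b <= 1 by apply: (ratio01 m1 m0) => //; [exact: ltW|exact: ltr_wpDr].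
have c01 : 0 <= c <= 1
  by rewrite /c (addrC m1); apply: ratio01; rewrite ?addr_gt0// ltW.
have e01 : 0 <= e <= 1 by apply: (ratio01 m3 m2) => //; [exact: ltW|exact: ltr_wpDl].
(* A set is observable if it does not separate indistinguishable points. *)
pose F1 : set (set nat) := [set A | A 1%N <-> A 2%N].
pose F2 : set (set nat) := [set A | (A 0%N <-> A 1%N) /\ (A 2%N <-> A 3%N)].
have intE (A : set nat) (f : nat -> R) : (\int[P]_(i in A) (f i)%:E =
    (m0 * (\1_A 0%N * f 0%N) + m1 * (\1_A 1%N * f 1%N) +
     m2 * (\1_A 2%N * f 2%N) + m3 * (\1_A 3%N * f 3%N))%:E)%E.
  by rewrite intP !big_ord_recr big_ord0 /m/= add0r.
have indic_eq (A : set nat) i j : (A i <-> A j) -> \1_A i = \1_A j :> R.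
  move=> AA; rewrite !indicE; have -> // : (i \in A) = (j \in A).
  by apply/idP/idP; rewrite !inE => /AA.
have FC (A : set nat) i j : (A i <-> A j) -> ((setT `\` A) i <-> (setT `\` A) j).
  by move=> [AB BA]; split=> -[_ nA]; split=> // ?; apply: nA; auto.
have FU (A : (set nat)^nat) i j : (forall k, A k i <-> A k j) ->
    ((\bigcup_k A k) i <-> (\bigcup_k A k) j).
  by move=> AB; split=> -[k _ ?]; exists k => //; apply/AB.
have bE : b * (m0 + m1) = m1 by rewrite divfK// gt_eqF// ltr_wpDl.
have cE : c * (m1 + m2) = m1 by rewrite divfK// gt_eqF// addr_gt0.
have eE : e * (m2 + m3) = m3 by rewrite divfK// gt_eqF// ltr_wpDr.
have bint (f : nat -> R) : (forall i, 0 <= f i <= 1) -> P.-integrable setT (EFin \o f).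
  move=> f01; apply: (@bounded_integrable _ _ _ _ _ 1) => // w.
  by have /andP[? ?] := f01 w; rewrite ger0_norm.
have X1_01 i : 0 <= X1 i <= 1.
  by case: i => [|[|[|[|i]]]] //=; rewrite ?nth_nil ?lexx ?ler01.
have X2_01 i : 0 <= X2 i <= 1.
  by case: i => [|[|[|[|i]]]] //=; rewrite ?nth_nil ?lexx ?ler01.
have coh : coherent p (joint_distribution X1 X2).
  split.
    rewrite -(@probability_setT _ _ _ P); congr (P _); apply/seteqP.
    by split=> // i _; split; rewrite /= in_itv/= ?X1_01 ?X2_01.
  exists _, nat, P, X, F1, F2, X1, X2; split => //.
  - split; last first.
      rewrite expectation_def (intE setT X) !indicE !in_setT/=; congr EFin.
      by rewrite pE; ring.
    case=> [|[|[|[|i]]]]/=; rewrite ?nth_nil; by [left|right].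
  - split; split=> //; split.
    + by [].
    + by move=> A A12; exact: FC.
    + by move=> A A12; exact: FU.
    + by [].
    + by move=> A [A01 A23]; split; exact: FC.
    + by move=> A A0; split; apply: FU => n; have [] := A0 n.
  - split; [by []|exact: bint|move=> A /indic_eq A12].
    rewrite (intE A X1) (intE A X) A12/=; congr EFin.
    transitivity (\1_A 2%N * (c * (m1 + m2)) + m3 * \1_A 3%N); first by ring.
    by rewrite cE; ring.
  - split; [by []|exact: bint|move=> A [/indic_eq A01 /indic_eq A23]].
    rewrite (intE A X2) (intE A X) A01 A23/=; congr EFin.
    transitivity (\1_A 1%N * (b * (m0 + m1)) + \1_A 3%N * (e * (m2 + m3))); first by ring.
    by rewrite bE eE; ring.
split => //; rewrite (coherent_covariance coh) integral_distributionT; last first.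
  by apply/measurable_EFinP; apply: measurable_funM; exact: measurable_funB.
rewrite (intE setT (fun w => (X1 w - p) * (X2 w - p))) !indicE !in_setT /=.
congr EFin.
transitivity (m1 * c * b + m2 * c * e + m3 * e - p * (c * (m1 + m2) + m3)
  - p * (b * (m0 + m1) + e * (m2 + m3)) + p ^+ 2 * (m0 + m1 + m2 + m3)).
  by ring.
by rewrite bE cE eE m_sum -pE; ring.
Qed.

End chain.

(** In the middle range the masses are those that produce the posteriors 3p/2,
    1/2 and (3p - 1)/2 demanded by x + y = (3p + X)/2.  Outside of it one end of
    the chain carries no mass, which leaves a symmetric three-point law. *)
Lemma min_cov_value_attained (R : realType) (p : R) : 0 < p -> p < 1 ->
  exists (P : probability nat R) (X1 X2 : {RV P >-> R}),
    coherent p (joint_distribution X1 X2) /\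
    covariance P X1 X2 = (min_cov_value p)%:E.
Proof.
move=> p0 p1; rewrite /min_cov_value; case: ltP => [plt|ple].
  have [||||||P [X1 [X2 [coh covE]]]] :=
    @coherent_chain R ((1 - p) / 2) p ((1 - p) / 2) 0 _ _ _ _ _ p; try lra.
  exists P, X1, X2; split => //; rewrite covE; congr EFin.
  by field; rewrite ?andbT; do ?[apply/andP; split]; apply/eqP; lra.
case: leP => [ple2|pgt].
  have pq : 0 < p * (1 - p) by rewrite mulr_gt0//; lra.
  have pqE : 3 * p * (1 - p) / 2 = 3 / 2 * (p * (1 - p)) by ring.
  have [||||||P [X1 [X2 [coh covE]]]] := @coherent_chain R
    ((1 - p) * (2 - 3 * p) / 2) (3 * p * (1 - p) / 2) (3 * p * (1 - p) / 2)
    (p * (3 * p - 1) / 2) _ _ _ _ _ p.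
  - by rewrite divr_ge0// mulr_ge0; lra.
  - by lra.
  - by lra.
  - by rewrite divr_ge0// mulr_ge0; lra.
  - by field.
  - by field.
  exists P, X1, X2; split => //; rewrite covE; congr EFin.
  have d1 : 3 * p * (1 - p) + p * (3 * p - 1) = 2 * p by ring.
  have d2 : (1 - p) * (2 - 3 * p) + 3 * p * (1 - p) = 2 * (1 - p) by ring.
  by field; rewrite d1 d2; apply/and3P; split; apply/eqP; lra.
have [||||||P [X1 [X2 [coh covE]]]] :=
  @coherent_chain R 0 (p / 2) (1 - p) (p / 2) _ _ _ _ _ p; try lra.
exists P, X1, X2; split => //; rewrite covE; congr EFin.
by field; rewrite ?andbT; do ?[apply/andP; split]; apply/eqP; lra.
Qed.

Theorem theorem1p2 (R : realType) (p : R) (hp0 : 0 < p) (hp1 : p < 1) :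
  exists M m : \bar R,
    [/\ is_max (coherent_integrals p (fun x => - ((x.1 - p) * (x.2 - p)))) M,
        is_min (coherent_covariances p) m,
        (- M)%E = m
      & m = (min_cov_value p)%:E].
Proof.
have [phi [K0 [K1 [feas valE]]]] := exists_dual_certificate hp0 hp1.
have [P [X1 [X2 [coh covE]]]] := min_cov_value_attained hp0 hp1.
exists (- min_cov_value p)%:E, (min_cov_value p)%:E; split => //.
- split.
    exists (joint_distribution X1 X2) => //.
    have [M [_ _ covM -> _]] := coherent_moments coh.
    move: covE; rewrite (coherent_covariance coh) covM => -[<-].
    by rewrite opprB.
  move=> _ [mu mu_coh <-]; have [M [_ _ _ -> bound]] := coherent_moments mu_coh.
  by rewrite lee_fin lerNr opprB lerBrDr valE; exact: bound feas.
- split; first by exists _, nat, P, X1, X2; rewrite covE.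
  move=> _ [d [T [Q [Y1 [Y2 [Q_coh ->]]]]]].
  have [M [_ _ covM _ bound]] := coherent_moments Q_coh.
  by rewrite (coherent_covariance Q_coh) covM lee_fin lerBrDr valE; exact: bound feas.
- by rewrite EFinN oppeK.
Qed.
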